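(* There is a randomized distributed algorithm (called Wireless\_DFS) that, in the bare-bones SINR model with weak sensitivity and weak connectivity and from an uncoordinated start with a single source, accomplishes broadcast of the source's rumor (so every node receives the rumor and is awoken) in $O(n\log^2 N)$ rounds with high probability. The total number of random bits used per node is $O(\log^3 N)$.
   Context: Model: $n$ nodes located in the Euclidean plane, each with a unique name in $\{1,\dots,N\}$, $N\ge n$. Synchronous rounds; in each round a node transmits or listens; no collision detection. Uniform transmission power $P$; constants $\alpha>2$, $\mathcal{N}>0$, $\beta\ge1$, $\varepsilon\in(0,1)$; $r=(P/(\mathcal{N}\beta))^{1/\alpha}$. If the set $\mathcal{T}$ transmits in a round, then $u\notin\mathcal{T}$ receives the message of $v\in\mathcal{T}$ iff $\frac{P\,\mathrm{dist}(v,u)^{-\alpha}}{\mathcal{N}+\sum_{w\in\mathcal{T}\setminus\{v\}}P\,\mathrm{dist}(w,u)^{-\alpha}}\ge\beta$ and $\mathrm{dist}(v,u)\le(1-\varepsilon)r$ (weak sensitivity). The communication graph $G$ joins $u,v$ iff $\mathrm{dist}(u,v)\le(1-\varepsilon)r$ (weak connectivity); $G$ is assumed connected; $\Delta$ is its maximum degree. Bare-bones: nodes know only their own name, $N$ and $\Delta$ (not $n$, their positions, or their neighbors); each message carries at most one rumor plus $O(\log N)$ control bits. Uncoordinated start: only the source is awake at the beginning; any other node becomes awake (and may begin participating) only upon first receiving a message. ''With high probability'' means with probability at least $1-n^{-d}$ for a sufficiently large constant $d\ge1$. *)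

(* Defs.v *)
From HB Require Import structures.
From mathcomp Require Import all_boot all_order all_algebra.
From mathcomp Require Import all_classical all_reals exp.
Set Implicit Arguments. Unset Strict Implicit. Unset Printing Implicit Defensive.
Import Order.TTheory GRing.Theory Num.Theory.
Local Open Scope ring_scope.

(* A message: (carries_rumor, control_bits).  The rumor itself is opaque;
   a transmitted rumor flag is only effective if the sender knows the rumor. *)
Definition msg := (bool * seq bool)%type.

(* A (randomized, bare-bones) distributed algorithm.
   - alg_bits N Delta : the number of random bits given to each node
     (its private random tape, uniformly distributed).
   - alg_act name N Delta is_source tape history : the action of an awake node
     in its next local round (None = listen, Some m = transmit m), depending
     only on its own name, N, Delta, whether it is the source, its random
     tape and its local history since wake-up (one entry per local round:
     the message received in that round, if any). *)
Record algorithm := Algorithm {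
  alg_bits : nat -> nat -> nat;
  alg_act : nat -> nat -> nat -> bool -> seq bool -> seq (option msg) -> option msg
}.

Section SINR.
Variable R : realType.
Variables (alpha beta eps P noise : R).

Definition dist (x y : R * R) : R :=
  Num.sqrt ((x.1 - y.1) ^+ 2 + (x.2 - y.2) ^+ 2).

Definition sinr_range : R := (P / (noise * beta)) `^ (alpha^-1).
Definition comm_range : R := (1 - eps) * sinr_range.

Variable n : nat.
Variable pos : 'I_n -> R * R.

Definition signal (v u : 'I_n) : R := P * (dist (pos v) (pos u)) `^ (- alpha).

Definition receives (T : {set 'I_n}) (v u : 'I_n) : bool :=
  [&& v \in T, u \notin T,
      signal v u / (noise + \sum_(w in T :\ v) signal w u) >= beta &
      dist (pos v) (pos u) <= comm_range].

Definition adj : rel 'I_n :=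
  fun u v => (u != v) && (dist (pos u) (pos v) <= comm_range).
Definition graph_connected : Prop := forall u v : 'I_n, connect adj u v.
Definition max_degree : nat := (\max_(v : 'I_n) #|[set u | adj v u]|)%N.

Variables (A : algorithm) (name : 'I_n -> nat) (N Delta : nat) (source : 'I_n).
Variable tape : 'I_n -> seq bool.

Definition knows_rumor (v : 'I_n) (h : seq (option msg)) : bool :=
  (v == source) || has (fun o => if o is Some m then m.1 else false) h.

(* global configuration: None = asleep, Some h = awake with local history h *)
Definition config := 'I_n -> option (seq (option msg)).

Definition init_config : config := fun v => if v == source then Some [::] else None.

Definition action (c : config) (v : 'I_n) : option msg :=
  match c v with
  | None => None
  | Some h =>
      match alg_act A (name v) N Delta (v == source) (tape v) h with
      | None => None
      | Some m => Some (m.1 && knows_rumor v h, m.2)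
      end
  end.

Definition transmitters (c : config) : {set 'I_n} :=
  [set v | isSome (action c v)].

Definition received (c : config) (u : 'I_n) : option msg :=
  match [pick v | receives (transmitters c) v u] with
  | Some v => action c v
  | None => None
  end.

Definition step (c : config) : config := fun u =>
  match c u with
  | Some h => Some (rcons h (received c u))
  | None => if received c u is Some m then Some [:: Some m] else None
  end.

Definition config_at (t : nat) : config := iter t step init_config.

Definition informed_at (t : nat) (v : 'I_n) : bool :=
  if config_at t v is Some h then knows_rumor v h else false.

Definition broadcast_done (t : nat) : bool := [forall v, informed_at t v].

End SINR.

Definition success_prob (R : realType) (alpha beta eps P noise : R)
  (n : nat) (pos : 'I_n -> R * R) (A : algorithm) (name : 'I_n -> nat)
  (N : nat) (source : 'I_n) (t : nat) : R :=
  let Delta := max_degree alpha beta eps P noise pos in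
  let B := alg_bits A N Delta in
  (#|[set tp : {ffun 'I_n -> B.-tuple bool} |
       broadcast_done alpha beta eps P noise pos A name N Delta source
         (fun v => tval (tp v)) t]|%:R
   / #|{: {ffun 'I_n -> B.-tuple bool}}|%:R).

(* Main.v *)
(* No random bits are needed: the algorithm below is a deterministic depth-first
   search carried out by a single token.

   The holder [v] of the token calls its unvisited neighbours, which become
   candidates.  With [L] the length of a name in bits, [2L] elimination rounds
   follow, one for each (bit, value) pair: [v] and the candidates whose name has
   that bit value transmit, and a silent candidate that fails to hear [v] drops
   out.  If no candidate transmits, nobody drops out, so some candidate always
   survives.  If a silent [u] hears [v] while [w] transmits, then [u] is nearer
   to [v] than to [w], because [beta >= 1].  Any two names differ in some bit, so
   survivors are pairwise farther from each other than from [v]; there are at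
   most 7 such points in the plane.  Among (bit, value) pairs one can halve a set
   twice, 7 -> 3 -> 1, so during the [(2L)^2] rounds where the survivors matching
   two prescribed pairs transmit, some survivor transmits alone and is heard by
   [v].  The token then goes to a survivor heard by [v], or back to the parent of
   [v] if there is none.  At most [2n] sessions of [O(L^2)] rounds visit all nodes. *)
Require Import Defs.
From HB Require Import structures.
From mathcomp Require Import all_boot all_order all_algebra.
From mathcomp Require Import all_classical all_reals exp.
From mathcomp Require Import zify ring lra.
Set Implicit Arguments.
Unset Strict Implicit.
Unset Printing Implicit Defensive.
Import Order.TTheory GRing.Theory Num.Theory.
Local Open Scope nat_scope.

(** * Names and bit tests *)

Definition bit k i := odd (k %/ 2 ^ i).

Lemma eq_bits L x y : x < 2 ^ L -> y < 2 ^ L ->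
  (forall i, i < L -> bit x i = bit y i) -> x = y.
Proof.
elim: L x y => [|L IH] x y; first by rewrite expn0 !ltnS !leqn0 => /eqP-> /eqP->.
move=> ltx lty eqb; rewrite -[x]odd_double_half -[y]odd_double_half.
have := eqb 0 isT; rewrite /bit expn0 !divn1 => ->; congr (_ + _.*2).
apply: IH => [||i ltiL].
- by rewrite -divn2 ltn_divLR// mulnC -expnS.
- by rewrite -divn2 ltn_divLR// mulnC -expnS.
- by rewrite /bit -!divn2 -!divnMA -expnS; exact: eqb.
Qed.

Definition code L k := mkseq (bit k) L.

Lemma size_code L k : size (code L k) = L.
Proof. exact: size_mkseq. Qed.

Lemma code_inj L x y : x < 2 ^ L -> y < 2 ^ L -> code L x = code L y -> x = y.
Proof.
move=> ltx lty eqc; apply: eq_bits ltx lty _ => i ltiL.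
by have := congr1 (fun s => nth false s i) eqc; rewrite !nth_mkseq.
Qed.

(* Test [a < L.*2] checks bit [a], or, for [a >= L], that bit [a - L] is 0. *)
Definition slot L k a := if a < L then bit k a else ~~ bit k (a - L).

Lemma slotC L a : a < L.*2 ->
  exists2 a', a' < L.*2 & forall k, slot L k a' = ~~ slot L k a.
Proof.
move=> lta; rewrite /slot; case: (ltnP a L) => [ltaL|leLa].
  exists (a + L); first lia.
  by move=> k; rewrite ltnNge leq_addl/= addnK.
exists (a - L); first lia.
by move=> k; rewrite negbK ifT//; lia.
Qed.

Lemma slot_sep L x y : x < 2 ^ L -> y < 2 ^ L -> x != y ->
  exists a, [/\ a < L.*2, slot L x a & ~~ slot L y a].
Proof.
move=> ltx lty neq.
have [i ltiL neqi] : exists2 i, i < L & bit x i != bit y i.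
  apply: contrapT => eqb; case/eqP: neq; apply: eq_bits ltx lty _ => i ltiL.
  by apply/eqP; apply: contrapT => /negP neqi; apply: eqb; exists i.
have lti2 : i < L.*2 by lia.
have sl k : slot L k i = bit k i by rewrite /slot ltiL.
case xi : (bit x i).
  by exists i; rewrite !sl; split=> //; move: neqi; rewrite xi; case: bit.
have [a' lta' ea'] := slotC lti2; exists a'; rewrite !ea' !sl xi; split=> //.
by move: neqi; rewrite xi; case: bit.
Qed.

(** * Isolating one element of a small set by bit tests *)

Section Isolation.
Variables (V : finType) (name : V -> nat) (L : nat).
Hypotheses (L_gt0 : 0 < L) (name_lt : forall v, name v < 2 ^ L).
Hypothesis name_inj : injective name.
Implicit Types F : {set V}.

(** Two names in [F] differ in some bit, so a test and its complement split [F] into two nonempty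
    parts, the smaller with at most half of it. The [maxn 1] covers singletons, where one of two
    complementary tests keeps the element. *)
Lemma slot_halves F : F != finset.set0 -> exists2 a, a < L.*2 &
  0 < #|[set u in F | slot L (name u) a]| <= maxn 1 #|F|./2.
Proof.
move=> F0; have [|F1] := leqP #|F| 1.
  move=> leF1; have /cards1P[u defF] : #|F| == 1.
    by rewrite eqn_leq leF1 card_gt0.
  have [a lta sa] : exists2 a, a < L.*2 & slot L (name u) a.
    have lt0 : 0 < L.*2 by rewrite double_gt0.
    case s0 : (slot L (name u) 0); first by exists 0.
    by have [a lta ea] := slotC lt0; exists a; rewrite ?ea ?s0.
  exists a => //; have -> : [set u0 in F | slot L (name u0) a] = [set u].
    by apply/setP=> w; rewrite defF !inE; case: eqVneq => // ->.
  by rewrite cards1 leq_maxl.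
have [u [w [uF wF neq]]] : exists u w, [/\ u \in F, w \in F & u != w].
  by case/card_gt1P: F1 => u [w [uF wF neq]]; exists u, w.
have [|a [lta su sw]] := slot_sep (name_lt u) (name_lt w).
  by apply: contraNneq neq => /name_inj ->.
have [a' lta' ea'] := slotC lta.
set X := [set u in F | slot L (name u) a].
set Y := [set u in F | slot L (name u) a'].
have X0 : 0 < #|X| by apply/card_gt0P; exists u; rewrite inE uF.
have Y0 : 0 < #|Y| by apply/card_gt0P; exists w; rewrite inE wF ea'.
have cardF : #|F| = #|X| + #|Y|.
  have -> : X = F :&: [set u | slot L (name u) a] by apply/setP=> z; rewrite !inE.
  have -> : Y = F :\: [set u | slot L (name u) a].
    by apply/setP=> z; rewrite !inE ea' andbC.
  by rewrite cardsID.
have [leXY|ltYX] := leqP #|X| #|Y|.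
  exists a => //; rewrite X0/= leq_max cardF; apply/orP; right.
  by rewrite -[leqLHS]doubleK half_leq// -addnn leq_add2l.
exists a' => //; rewrite Y0/= leq_max cardF; apply/orP; right.
by rewrite -[leqLHS]doubleK half_leq// -addnn leq_add2r ltnW.
Qed.

(** The round number [j] encodes a pair of tests as two digits in base [L.*2]. *)
Definition pair_slot k j := slot L k (j %/ L.*2) && slot L k (j %% L.*2).

Lemma isolate F : F != finset.set0 -> #|F| <= 7 ->
  exists2 k, k < L.*2 ^ 2 &
    exists w, [set u in F | pair_slot (name u) k] = [set w].
Proof.
move=> F0 F7; have [a lta /andP[+ lea]] := slot_halves F0.
set G := [set _ in F | _] in lea *; rewrite card_gt0 => G0.
have [b ltb /andP[+ leb]] := slot_halves G0.
set H := [set _ in G | _] in leb *; move=> H0.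
have /cards1P[w defH] : #|H| == 1.
  rewrite eqn_leq H0 andbT; apply: leq_trans leb _; rewrite geq_max /=.
  have leG : #|G| <= 3.
    by apply: leq_trans lea _; rewrite geq_max /=; exact: half_leq F7.
  by have := half_leq leG.
exists (a * L.*2 + b); first by rewrite expnS expn1; nia.
exists w; rewrite -defH; apply/setP=> u; rewrite !inE /pair_slot.
by rewrite divnMDl ?double_gt0// divn_small// addn0 modnMDl modn_small// andbA.
Qed.

End Isolation.

(** * The protocol on an abstract radio network *)

Inductive packet :=
  Silence | Call of seq bool | Beep | Reply of seq bool | Token of seq bool.

(* [Idle]: not visited yet.  [Cand j p]: candidate in round [j] of the session of
   the node with code [p].  [Hold j p hd]: token holder in round [j] of its
   session, with parent [p] and last reply [hd].  [Done p]: visited, with parent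
   [p].  The source has the empty code as its parent. *)
Inductive state :=
  | Idle
  | Cand of nat & seq bool
  | Hold of nat & seq bool & option (seq bool)
  | Done of seq bool.

Definition active s := if s is Idle then false else true.
Definition passive s := if s is Idle then true else if s is Done _ then true else false.
Definition audible p := if p is Silence then false else true.

Definition sends L k j :=
  if j < L.*2 then slot L k j
  else (j < L.*2 + L.*2 ^ 2) && pair_slot L k (j - L.*2).

(** The clock of the holder runs one ahead of the candidates' clock because of the call round.
    [take L] caps the length of the token in every state, even those that no execution reaches. *)
Definition emit L k s :=
  match s with
  | Idle | Done _ => Silence
  | Cand j _ => if sends L k j then Reply (code L k) else Silence
  | Hold j p hd =>
      if j == 0 then Call (code L k)
      else if j <= L.*2 then Beep
      else if j <= L.*2 + L.*2 ^ 2 then Silence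
      else Token (take L (odflt p hd))
  end.

(** A candidate passed over returns to [Idle], so that a later session can call it again; [Done p]
    keeps [p], so that a returning token resumes the search with the same parent. *)
Definition next L k s pk :=
  match s, pk with
  | Idle, Call p => Cand 0 p
  | Idle, _ => Idle
  | Cand j p, Token x => if x == code L k then Hold 0 p None else Idle
  | Cand j p, Beep => Cand j.+1 p
  | Cand j p, _ => if (L.*2 <= j) || slot L k j then Cand j.+1 p else Idle
  | Hold j p hd, Reply z =>
      if j == (L.*2 + L.*2 ^ 2).+1 then Done p else Hold j.+1 p (Some z)
  | Hold j p hd, _ =>
      if j == (L.*2 + L.*2 ^ 2).+1 then Done p else Hold j.+1 p hd
  | Done p, Token x => if x == code L k then Hold 0 p None else Done p
  | Done p, _ => Done p
  end.

(* [rx T u] is the node that [u] hears when [T] transmits, and [nearer u v w]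
   means that [v] is nearer to [u] than [w] is. *)
Section Radio.
Variables (V : finType) (adj : rel V) (rx : {set V} -> V -> option V).
Variables (nearer : V -> V -> V -> Prop) (name : V -> nat) (L : nat).
Hypotheses (L_gt0 : 0 < L) (name_lt : forall v, name v < 2 ^ L).
Hypothesis name_inj : injective name.
Hypothesis adj_sym : symmetric adj.
Hypothesis rx1 : forall v u, rx [set v] u = if adj v u then Some v else None.
Hypothesis rxP : forall T u v, rx T u = Some v ->
  [/\ v \in T, u \notin T, adj v u &
      forall w, w \in T -> w != v -> nearer u v w].
Hypothesis packing : forall v (F : {set V}),
  {in F &, forall u w, u != w -> nearer u v w} -> #|F| <= 7.

Notation K := (L.*2 + L.*2 ^ 2).
Notation cd v := (code L (name v)).
Implicit Types (s : V -> state) (F : {set V}).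

Definition on_air s v := emit L (name v) (s v).
Definition air s : {set V} := [set v | audible (on_air s v)].
Definition hear s u := if rx (air s) u is Some v then on_air s v else Silence.
Definition gstep s : V -> state := fun u => next L (name u) (s u) (hear s u).

Lemma cd_inj u v : cd u = cd v -> u = v.
Proof. by move=> /(code_inj (name_lt u) (name_lt v))/name_inj. Qed.

Lemma take_cd v : take L (cd v) = cd v.
Proof. by rewrite take_oversize// size_code. Qed.

Lemma adj_irr v : adj v v = false.
Proof.
have := rx1 v v; case: (adj v v) => // /rxP[_]; by rewrite inE eqxx.
Qed.

Lemma emit_passive k x : passive x -> emit L k x = Silence.
Proof. by case: x. Qed.

Lemma hear_sole s v u : air s = [set v] ->
  hear s u = if adj v u then on_air s v else Silence.
Proof. by move=> e; rewrite /hear e rx1; case: ifP. Qed.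

Lemma hear_self s v : v \in air s -> hear s v = Silence.
Proof.
move=> va; rewrite /hear; case e: (rx _ _) => [w|//].
by have [_ /negP[]] := rxP e.
Qed.

(* A session of [v], [j.+1] rounds after its start from configuration [s]:
   [F] is the set of remaining candidates, [hd] the last reply heard. *)
Definition mid s v p j F hd : V -> state := fun u =>
  if u == v then Hold j.+1 p hd else if u \in F then Cand j (cd v) else s u.

(** * One session of the token holder *)

Section Session.
Variables (s : V -> state) (v : V) (p : seq bool).
Hypotheses (sv : s v = Hold 0 p None) (s_passive : forall u, u != v -> passive (s u)).

Let U : {set V} := [set u | adj v u & ~~ active (s u)].

Let U_adj F u : F \subset U -> u \in F -> adj v u.
Proof. by move=> /fintype.subsetP FU /FU; rewrite inE => /andP[]. Qed.

Let U_idle F u : F \subset U -> u \in F -> s u = Idle.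
Proof. by move=> /fintype.subsetP FU /FU; rewrite inE => /andP[_]; case: (s u). Qed.

Let v_notin F : F \subset U -> v \notin F.
Proof. by move=> FU; apply/negP=> /(U_adj FU); rewrite adj_irr. Qed.

Let neq_v F u : F \subset U -> u \in F -> (u == v) = false.
Proof. by move=> FU uF; apply: contraNF (v_notin FU) => /eqP <-. Qed.

Lemma call_step : gstep s = mid s v p 0 U None.
Proof.
have airE : air s = [set v].
  apply/setP=> u; rewrite !inE /on_air; case: eqVneq => [->|/s_passive].
    by rewrite sv.
  by move=> /emit_passive ->.
apply/funext => u; rewrite /gstep (hear_sole _ airE) /mid /on_air sv/= inE.
case: eqVneq => [->|neq]; first by rewrite adj_irr sv.
by have := s_passive neq; case: (s u) => //= *; case: adj.
Qed.

Lemma air_mid j F hd : F \subset U -> j <= K ->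
  air (mid s v p j F hd) =
  (if (j < L.*2) || (j == K) then [set v] else finset.set0) :|:
  [set u in F | sends L (name u) j].
Proof.
move=> FU leK; apply/setP=> u; rewrite !inE /on_air /mid /=.
case: (eqVneq u v) => [->|neq].
  rewrite (negbTE (v_notin FU)) /= orbF.
  case: ltnP => [_|le2]; first by rewrite inE eqxx.
  by case: ltngtP leK => // jK _; rewrite ?inE ?eqxx.
case: ifP => uF /=.
  by case: ((j < _) || _); rewrite !inE ?(negbTE neq)/=; case: sends.
rewrite emit_passive ?s_passive//= orbF.
by case: ((j < _) || _); rewrite !inE ?(negbTE neq).
Qed.

(** [F'] collects the transmitters and those that hear [v]. If no candidate transmits, [v] is alone
    on air and [rx1] lets all of [F] hear it, so [F'] is nonempty. A silent member of [F'] heard [v]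
    over every other transmitter, which [rxP] turns into [nearer]. *)
Lemma elim_step j F : F \subset U -> j < L.*2 ->
  exists F', [/\ F' \subset F, F != finset.set0 -> F' != finset.set0,
    gstep (mid s v p j F None) = mid s v p j.+1 F' None &
    forall u w, u \in F' -> w \in F -> slot L (name w) j ->
      ~~ slot L (name u) j -> nearer u v w].
Proof.
move=> FU ltj; have leK : j <= K by lia.
set t := mid _ _ _ _ _ _.
have airE : air t = v |: [set u in F | slot L (name u) j].
  by rewrite air_mid// ltj /sends ltj.
pose F' := [set u in F | slot L (name u) j || (rx (air t) u == Some v)].
have sendsE u : sends L (name u) j = slot L (name u) j by rewrite /sends ltj.
have leF : (L.*2 <= j) = false by rewrite leqNgt ltj.
exists F'; split.
- by apply/fintype.subsetP=> u; rewrite inE => /andP[].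
- move=> /set0Pn[u uF].
  have [/pred0P none|/pred0Pn[w /andP[/= wF sw]]] :=
    boolP (pred0b [pred w in F | slot L (name w) j]).
    apply/set0Pn; exists u; rewrite inE uF.
    suff -> : air t = [set v] by rewrite rx1 (U_adj FU uF) eqxx orbT.
    apply/setP=> w; rewrite airE !inE; have /= -> := none w.
    by rewrite orbF.
  by apply/set0Pn; exists w; rewrite inE wF sw.
- have va : v \in air t by rewrite airE setU11.
  have tv : t v = Hold j.+1 p None by rewrite /t /mid eqxx.
  apply/funext => u; rewrite /gstep; case: (eqVneq u v) => [->|neq].
    rewrite hear_self// tv /mid eqxx /= eqSS ifF//; lia.
  have beepE w : rx (air t) u = Some w ->
      hear t u = if w == v then Beep else Reply (cd w).
    move=> e; rewrite /hear e /on_air; case: (eqVneq w v) => [->|wv].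
      by rewrite tv /= ltj.
    have [+ _ _ _] := rxP e; rewrite airE !inE (negbTE wv)/= => /andP[wF sw].
    by rewrite /t /mid (negbTE wv) wF /= sendsE sw.
  have midE k G : mid s v p k G None u = if u \in G then Cand k (cd v) else s u.
    by rewrite /mid (negbTE neq).
  rewrite midE {1}/t midE inE.
  case: ifP => uF /=; last first.
    have := s_passive neq; case: (s u) => //= [_|q _].
      by rewrite /hear; case e: rx => [w|//]; move: (beepE _ e);
         rewrite /hear e => ->; case: ifP.
    by rewrite /hear; case e: rx => [w|//]; move: (beepE _ e);
         rewrite /hear e => ->; case: ifP.
  rewrite (U_idle FU uF).
  case e: (rx (air t) u) => [w|]; last by rewrite /hear e /= leF orbF.
  rewrite (beepE _ e) (inj_eq Some_inj).
  by case: ifP => wv /=; rewrite ?orbT// leF orbF.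
- move=> u w; rewrite inE => /andP[uF /orP[->//|/eqP /rxP[_ _ _ near]]] wF sw _.
  by apply: near; rewrite ?airE ?inE ?wF ?sw ?orbT// (neq_v FU wF).
Qed.

Lemma elim_phase j : j <= L.*2 -> exists F,
  [/\ F \subset U, U != finset.set0 -> F != finset.set0,
    iter j gstep (mid s v p 0 U None) = mid s v p j F None &
    forall u w i, u \in F -> w \in F -> i < j -> slot L (name w) i ->
      ~~ slot L (name u) i -> nearer u v w].
Proof.
elim: j => [_|j IH ltj]; first by exists U; split.
have [F [FU F0 itF sepF]] := IH (ltnW ltj).
have [F' [F'F F'0 stF' sepF']] := elim_step FU ltj.
exists F'; split.
- exact: fintype.subset_trans FU.
- by move=> /F0.
- by rewrite iterS itF.
move=> u w i uF' wF'; have wF := fintype.subsetP F'F _ wF'.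
rewrite ltnS leq_eqVlt => /orP[/eqP->|ltij]; first exact: sepF'.
by apply: sepF => //; exact: fintype.subsetP F'F _ uF'.
Qed.

(** For each ordered pair some test is passed by [w] and failed by [u], since bits are tested for
    both values; in its round [u] was silent and heard [v] over [w]. *)
Lemma survivors_le7 F :
  (forall u w i, u \in F -> w \in F -> i < L.*2 -> slot L (name w) i ->
      ~~ slot L (name u) i -> nearer u v w) -> #|F| <= 7.
Proof.
move=> sepF; apply: (packing (v := v)) => u w uF wF neq.
have [|i [lti sw su]] := slot_sep (name_lt w) (name_lt u).
  by apply: contraNneq neq => /name_inj ->.
exact: sepF su.
Qed.

Lemma isolation_step k F hd : F \subset U -> k < L.*2 ^ 2 ->
  gstep (mid s v p (L.*2 + k) F hd) = mid s v p (L.*2 + k.+1) F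
    (if rx [set u in F | pair_slot L (name u) k] v is Some w then Some (cd w)
     else hd).
Proof.
move=> FU ltk; set t := mid _ _ _ _ _ _.
have sendsE u : sends L (name u) (L.*2 + k) = pair_slot L (name u) k.
  by rewrite /sends ltnNge leq_addr/= ltn_add2l ltk addKn.
have airE : air t = [set u in F | pair_slot L (name u) k].
  rewrite air_mid//; last lia.
  rewrite ifF ?set0U; last lia.
  by apply/setP=> u; rewrite !inE sendsE.
have hearE u : hear t u = if rx (air t) u is Some w then Reply (cd w) else Silence.
  rewrite /hear; case e: rx => [w|//].
  have [+ _ _ _] := rxP e; rewrite airE inE => /andP[wF sw].
  by rewrite /on_air /t /mid (neq_v FU wF) wF /= sendsE sw.
rewrite -airE; apply/funext=> u; rewrite /gstep hearE {1}/t /mid.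
case: (eqVneq u v) => [->|neq].
  by rewrite /= addnS; case: rx => [w|]; rewrite eqSS ifF//; lia.
case: ifP => uF; first by rewrite addnS /= leq_addr; case: rx.
by have := s_passive neq; case: (s u) => //=; case: rx.
Qed.

(** A recorded reply may be overwritten but is never erased, so one isolated transmission suffices;
    it reaches [v] by [rx1], as candidates are neighbours of [v]. *)
Lemma isolation_phase F k : F \subset U -> k <= L.*2 ^ 2 -> exists hd,
  [/\ iter k gstep (mid s v p L.*2 F None) = mid s v p (L.*2 + k) F hd,
    hd = None \/ exists2 w, w \in F & hd = Some (cd w) &
    forall i w, i < k -> [set u in F | pair_slot L (name u) i] = [set w] ->
      hd <> None].
Proof.
move=> FU; elim: k => [_|k IH ltk].
  by exists None; split; [rewrite addn0|left|].
have [hd [itF hdF iso]] := IH (ltnW ltk).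
eexists; split; first by rewrite iterS itF isolation_step.
  case e: rx => [w|//]; right; exists w => //.
  by have [+ _ _ _] := rxP e; rewrite inE => /andP[].
move=> i w; rewrite ltnS leq_eqVlt => /orP[/eqP->|ltik] isow.
  have wF : w \in F.
    by have : w \in [set w] by [rewrite inE]; rewrite -isow inE => /andP[].
  by rewrite isow rx1 adj_sym (U_adj FU wF).
by case: rx => // ; exact: iso isow.
Qed.

Lemma token_step F hd : F \subset U ->
  gstep (mid s v p K F hd) = fun u =>
    if u == v then Done p else
    if adj v u && (take L (odflt p hd) == cd u) then
      if u \in F then Hold 0 (cd v) None else
      if s u is Done q then Hold 0 q None else s u
    else s u.
Proof.
move=> FU; set t := mid _ _ _ _ _ _.
have airE : air t = [set v].
  rewrite air_mid// eqxx orbT; apply/setP => u; rewrite !inE /sends ltnn.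
  by rewrite ltnNge leq_addr /= andbF orbF.
have tv : on_air t v = Token (take L (odflt p hd)).
  by rewrite /on_air /t /mid eqxx /= ltnNge leq_addr /= ltnn.
apply/funext=> u; rewrite /gstep (hear_sole _ airE) tv {1}/t /mid.
case: (eqVneq u v) => [->|neq]; first by rewrite adj_irr /= eqxx.
case: ifP => uF.
  by rewrite (U_adj FU uF)/=; case: ifP => // _; rewrite (U_idle FU uF).
by have := s_passive neq; case: (s u) => //= [_|q _]; case: (adj v u) => //=;
  case: ifP.
Qed.

(** Without a recorded reply, [isolate] shows that no survivor was left; elimination never empties a
    nonempty set, so [v] had no unvisited neighbour. Otherwise the last reply names a survivor, and
    injectivity of codes makes it the only taker of the token. *)
Lemma session :
  (forall u, adj v u -> active (s u)) /\
    iter K.+2 gstep s = (fun u => if u == v then Done p else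
      if adj v u && (take L p == cd u) then
        if s u is Done q then Hold 0 q None else s u
      else s u) \/
  exists w, [/\ adj v w, s w = Idle &
    iter K.+2 gstep s = fun u => if u == v then Done p else
      if u == w then Hold 0 (cd v) None else s u].
Proof.
have [F [FU F0 itF sepF]] := elim_phase (leqnn L.*2).
have F7 := survivors_le7 sepF.
have [hd [itK hdF iso]] := isolation_phase FU (leqnn (L.*2 ^ 2)).
(* The [K.+2] rounds are the call, [L.*2] eliminations, [L.*2 ^ 2] isolations and the token. *)
have -> : iter K.+2 gstep s = gstep (mid s v p K F hd).
  by rewrite iterS iterSr call_step addnC iterD itF itK addnC.
rewrite token_step//.
case: hdF => [hdN|[w wF ->]]; last first.
  right; exists w; rewrite (U_adj FU wF) (U_idle FU wF); split=> //=.
  apply/funext=> u; rewrite take_cd; case: ifP => // _.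
  case: (eqVneq u w) => [->|neq]; first by rewrite (U_adj FU wF) eqxx wF.
  by rewrite ifF//; apply/negP=> /andP[_ /eqP/cd_inj e]; rewrite e eqxx in neq.
have F_eq0 : F = finset.set0.
  apply/eqP; apply: contraT => Fn0.
  have [i lti [w isow]] := isolate L_gt0 name_lt name_inj Fn0 F7.
  by have := iso i w lti isow; rewrite hdN.
left; split.
  move=> u vu; apply: contraT => su.
  have /F0 : U != finset.set0 by apply/set0Pn; exists u; rewrite inE vu.
  by rewrite F_eq0 eqxx.
by rewrite F_eq0 hdN; apply/funext=> u; rewrite !inE.
Qed.

End Session.

(** * Depth-first search by successive sessions *)

Definition parent (r : seq V) := if r is y :: _ then cd y else [::].

Fixpoint chain s (r : seq V) :=
  if r is y :: r' then s y = Done (parent r') /\ chain s r' else True.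

Lemma eq_chain s s' r : {in r, s =1 s'} -> chain s r -> chain s' r.
Proof.
elim: r => //= y r IH eqs [sy ch]; split; first by rewrite -eqs ?mem_head.
by apply: IH => // u ur; rewrite eqs// inE ur orbT.
Qed.

Lemma chain_active s r u : chain s r -> u \in r -> active (s u).
Proof.
elim: r => //= y r IH [sy ch]; rewrite inE => /orP[/eqP->|]; first by rewrite sy.
exact: IH.
Qed.

(* [stk] is the path of the search tree from the token holder to the source. *)
Record dfs s (stk : seq V) : Prop := Dfs {
  dfs_chain : if stk is v :: r then s v = Hold 0 (parent r) None /\ chain s r
              else True;
  dfs_passive : forall u, ohead stk != Some u -> passive (s u);
  dfs_uniq : uniq stk;
  dfs_sorted : sorted adj stk;
  dfs_closed : forall u w, active (s u) -> u \notin stk -> adj u w -> active (s w)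
}.

Definition actives s : {set V} := [set u | active (s u)].

(** The outcomes of [session] are a pop and a push. A popped [v] joins the active nodes off the
    stack, and the pop outcome provides exactly what [dfs_closed] then asks of it: all its
    neighbours are active. *)
Lemma dfs_step s v r : dfs s (v :: r) -> exists stk,
  [/\ dfs (iter K.+2 gstep s) stk,
      actives s \subset actives (iter K.+2 gstep s) &
      #|actives (iter K.+2 gstep s)|.*2 + (size r).+1 =
      (#|actives s|.*2 + size stk).+1].
Proof.
case=> -[sv ch] pas uvr srt clo; have /andP[vr ur] := uvr.
have pasv u : u != v -> passive (s u).
  by move=> neq; apply: pas; rewrite /= (inj_eq Some_inj) eq_sym.
have neq_r u : u \in r -> (u == v) = false.
  by move=> uin; apply: contraNF vr => /eqP <-.
case: (session sv pasv) => [[full ->]|[w [vw sw ->]]]; last first.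
  have wv : (w == v) = false.
    by apply/eqP => e; rewrite e sv in sw.
  have wr : w \notin r by apply/negP => /(chain_active ch); rewrite sw.
  set s' : V -> state := fun u => _.
  have actE : actives s' = w |: actives s.
    apply/setP=> u; rewrite !inE /s'.
    case: (eqVneq u v) => [->|_]; first by rewrite sv orbT.
    by case: eqVneq.
  exists [:: w, v & r]; split.
  - split=> /=.
    + rewrite /s' wv !eqxx; split=> //; split=> //.
      apply: eq_chain ch => u uin; rewrite neq_r// ifF//.
      by apply: contraNF wr => /eqP <-.
    + move=> u; rewrite (inj_eq Some_inj) /s' eq_sym => /negbTE ->.
      by case: eqVneq => // /pasv.
    + by rewrite inE negb_or wv wr vr.
    + by rewrite adj_sym vw.
    + move=> u z su unin uz.
      move: unin; rewrite !inE !negb_or => /and3P[uw uv unr].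
      have su0 : active (s u) by move: su; rewrite /s' (negbTE uv) (negbTE uw).
      have : z \in actives s'.
        by rewrite actE !inE (clo u z su0 _ uz) ?orbT// inE negb_or uv.
      by rewrite inE.
  - by rewrite actE finset.subsetUr.
  - by rewrite actE cardsU1 !inE sw /=; lia.
set s' : V -> state := fun u => _.
have actE : actives s' = actives s.
  apply/setP=> u; rewrite !inE /s'.
  case: (eqVneq u v) => [->|_]; first by rewrite sv.
  by case: ifP => // _; case: (s u).
have act u : active (s' u) = active (s u).
  by have := congr1 (fun A : {set V} => u \in A) actE; rewrite /= !inE.
have clo' u w : active (s' u) -> u \notin r -> adj u w -> active (s' w).
  rewrite !act => su unin uw; case: (eqVneq u v) => [uv|uv].
    by apply: full; rewrite -uv.
  by apply: clo su _ uw; rewrite inE negb_or uv.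
exists r; split; rewrite ?actE//; last by lia.
(* When the source itself is popped, the token carries the empty code; codes of nodes have length
   [L > 0], so nobody takes it and the search stops. *)
case: r ch => [|y r] /= ch in ur srt vr sv pas clo uvr neq_r s' actE act clo' *.
  split=> // u _; rewrite /s'; case: (eqVneq u v) => // uv.
  rewrite ifF ?pasv//; apply/negP => /andP[_ /eqP e].
  by have := congr1 size e; rewrite size_code /= => L0; move: L_gt0; rewrite -L0.
case: ch => sy ch; case/andP: ur => yr ur; case/andP: srt => vy srt.
have s'E u : u != v -> u != y -> s' u = s u.
  move=> uv uy; rewrite /s' (negbTE uv) take_cd ifF//.
  by apply/negP => /andP[_ /eqP/cd_inj e]; rewrite e eqxx in uy.
split=> //.
- split.
    by rewrite /s' neq_r ?mem_head// vy take_cd eqxx sy.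
  apply: eq_chain ch => u uin; rewrite s'E//; last first.
    by apply: contraNneq yr => <-.
  by rewrite neq_r// inE uin orbT.
- move=> u; rewrite /= (inj_eq Some_inj) eq_sym => uy.
  case: (eqVneq u v) => [->|uv]; first by rewrite /s' eqxx.
  by rewrite s'E// pasv.
- by rewrite /= yr.
Qed.

Definition start (src : V) : V -> state :=
  fun u => if u == src then Hold 0 [::] None else Idle.

Lemma dfs_start src : dfs (start src) [:: src].
Proof.
split=> //=; first by rewrite /start eqxx.
- by move=> u; rewrite (inj_eq Some_inj) eq_sym /start => /negbTE ->.
- by move=> u w; rewrite /start inE; case: eqVneq.
Qed.

(* Each session either pushes a new node on the stack or pops its top, so
   [2 * #actives - size stk] grows by one. *)
Lemma dfs_terminates src : exists m,
  [/\ m <= #|V|.*2, dfs (iter (m * K.+2) gstep (start src)) [::] &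
      active (iter (m * K.+2) gstep (start src) src)].
Proof.
(* While the search runs, twice the number of active nodes is [m] plus the stack size plus one,
   because it starts at 2 with a stack of size 1. At [m = #|V|.*2] this exceeds [#|V|.*2]. *)
suff run m : (exists m', [/\ m' <= m, dfs (iter (m' * K.+2) gstep (start src)) [::] &
      active (iter (m' * K.+2) gstep (start src) src)]) \/
    exists v r, [/\ dfs (iter (m * K.+2) gstep (start src)) (v :: r),
      active (iter (m * K.+2) gstep (start src) src) &
      #|actives (iter (m * K.+2) gstep (start src))|.*2 = m + (size r).+2].
  case: (run #|V|.*2) => // -[v [r [_ _ e]]].
  have : #|actives (iter (#|V|.*2 * K.+2) gstep (start src))|.*2 <= #|V|.*2.
    by rewrite leq_double max_card.
  by rewrite e -[leqRHS]addn0 leq_add2l.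
elim: m => [|m [[m' [le_m' d a]]|[v [r [d a card]]]]].
- right; exists src, [::]; rewrite /= /start eqxx; split=> //.
    exact: dfs_start.
  suff -> : actives (start src) = [set src] by rewrite cards1.
  by apply/setP=> u; rewrite !inE /start; case: eqVneq.
- by left; exists m'; split=> //; rewrite leqW.
have [stk [d' /fintype.subsetP act card']] := dfs_step d.
have itE : iter (m.+1 * K.+2) gstep (start src) =
    iter K.+2 gstep (iter (m * K.+2) gstep (start src)).
  by rewrite mulSn iterD.
have a' : active (iter (m.+1 * K.+2) gstep (start src) src).
  by have := act src; rewrite itE !inE; apply.
rewrite -itE in d' card'.
case: stk d' card' => [|v' r'] d' card'; first by left; exists m.+1.
by right; exists v', r'; split=> //; move: card' => /=; lia.
Qed.

(** Once the stack is empty, [dfs_closed] makes the set of active nodes closed under adjacency, so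
    connectivity spreads activity from the source to all nodes. *)
Lemma all_active src : (forall u, connect adj src u) -> exists2 t,
  t <= #|V|.*2 * K.+2 & forall u, active (iter t gstep (start src) u).
Proof.
move=> conn; have [m [lem d asrc]] := dfs_terminates src.
exists (m * K.+2); first by rewrite leq_mul2r lem orbT.
move=> u; have /connectP[q + ->] := conn u.
move: d asrc; set t := iter _ _ _ => d asrc.
elim: q (src) asrc => //= w q IH x ax /andP[xw].
by apply: IH; exact: (dfs_closed d ax _ xw).
Qed.

End Radio.

Local Open Scope ring_scope.

(** * Geometry and SINR reception *)

Section Packing.
Variable R : realFieldType.

(** Coordinates of equal sign have a product at least the smaller of their squares. If [p] dominates
    and [p ^+ 2 <= p * p'], then [p ^+ 2 + q ^+ 2 <= 2 * p ^+ 2 <= 2 * (p * p')], and [q * q'] only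
    helps; the other cases are alike. *)
Lemma same_sector (p q p' q' : R) :
  (0 <= q) = (0 <= q') -> (0 <= p) = (0 <= p') ->
  (q ^+ 2 <= p ^+ 2) = (q' ^+ 2 <= p' ^+ 2) ->
  p ^+ 2 + q ^+ 2 <= 2 * (p * p' + q * q') \/
  p' ^+ 2 + q' ^+ 2 <= 2 * (p * p' + q * q').
Proof.
have same_sign (x y : R) : (0 <= x) = (0 <= y) ->
    0 <= x * y /\ (x ^+ 2 <= x * y \/ y ^+ 2 <= x * y).
  case: (lerP 0 x) => hx; case: (lerP 0 y) => hy // _.
    split; first by rewrite mulr_ge0.
    by case: (lerP x y) => xy; [left|right]; nra.
  by split; [nra|case: (lerP x y) => xy; [right|left]; nra].
move=> /same_sign[q0 qq] /same_sign[p0 pp].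
case: (lerP (q ^+ 2) (p ^+ 2)) => h; case: (lerP (q' ^+ 2) (p' ^+ 2)) => h' // _.
  by case: pp => ?; [left|right]; lra.
by case: qq => ?; [left|right]; lra.
Qed.

(* The hypothesis says that [w] is nearer to the origin than to [u].  Fix [f] in [F] and cut the plane
   into octants starting from the direction of [f]: the two octants adjacent to
   [f] contain no other point of [F], and each other octant at most one. *)
Lemma kissing7 (T : finType) (x y : T -> R) (F : {set T}) :
  {in F &, forall u w, u != w ->
     2 * (x u * x w + y u * y w) < x u ^+ 2 + y u ^+ 2} ->
  (#|F| <= 7)%N.
Proof.
move=> sep; have [->|/set0Pn[f fF]] := eqVneq F finset.set0; first by rewrite cards0.
rewrite (cardsD1 f) fF add1n ltnS.
(* Up to the factor of the norm of [f], these are the coordinates of [u] in a frame whose first axis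
   points to [f]; [sector] is the octant in this frame. *)
pose p u := x u * x f + y u * y f; pose q u := x u * y f - y u * x f.
pose sector u := (0 <= q u, 0 <= p u, q u ^+ 2 <= p u ^+ 2).
pose D := x f ^+ 2 + y f ^+ 2.
have normE u : (x u ^+ 2 + y u ^+ 2) * D = p u ^+ 2 + q u ^+ 2.
  by rewrite /D /p /q; ring.
have dotE u w : (x u * x w + y u * y w) * D = p u * p w + q u * q w.
  by rewrite /D /p /q; ring.
have sepf u : u \in F :\ f -> 2 * p u < D /\ 2 * p u < x u ^+ 2 + y u ^+ 2.
  rewrite !inE => /andP[uf uF]; split; last exact: sep.
  by have := sep f u fF uF; rewrite eq_sym uf /p /D => /(_ isT); lra.
have D_gt0 u : u \in F :\ f -> 0 < D.
  move=> /sepf[lt1 lt2]; rewrite lt_neqAle eq_sym addr_ge0 ?sqr_ge0// andbT.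
  apply/negP => /eqP D0; have xf0 : x f = 0 by rewrite /D in D0; nra.
  have yf0 : y f = 0 by rewrite /D in D0; nra.
  by move: lt1; rewrite D0 /p xf0 yf0; lra.
have sector_inj : {in F :\ f &, injective sector}.
  move=> u w uF wF [eq1 eq2 eq3]; apply/eqP; apply: contraT => neq.
  have D0 := D_gt0 u uF.
  have [uF' wF'] : u \in F /\ w \in F by move: uF wF; rewrite !inE => /andP[_ ->] /andP[_ ->].
  have scaled a b : a \in F -> b \in F -> a != b ->
      2 * (p a * p b + q a * q b) < p a ^+ 2 + q a ^+ 2.
    by move=> aF bF ab; rewrite -dotE -normE mulrA ltr_pM2r// sep.
  have := scaled u w uF' wF' neq; rewrite eq_sym in neq.
  have := scaled w u wF' uF' neq; rewrite (mulrC (p w)) (mulrC (q w)) => l1 l2.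
  by case: (same_sector eq1 eq2 eq3); lra.
rewrite -(card_in_imset sector_inj).
(* Of the eight octants, the two excluded are those with [0 <= p u] and [q u ^+ 2 <= p u ^+ 2],
   adjacent to [f]. *)
have -> : 6%N = #|~: [set (false, true, true); (true, true, true)]|.
  by rewrite cardsCs finset.setCK cards2 !card_prod card_bool.
apply: subset_leq_card; apply/fintype.subsetP=> _ /imsetP[u uF ->].
rewrite !inE /sector; apply/negP => H.
have [p0 qp] : 0 <= p u /\ q u ^+ 2 <= p u ^+ 2.
  by case/orP: H => /eqP[_ -> ->].
have D0 := D_gt0 u uF; have [l1 l2] := sepf u uF.
(* Here [2 * p u * D < p u ^+ 2 + q u ^+ 2 <= 2 * p u ^+ 2] forces [D < p u], against
   [2 * p u < D]. *)
move: l2; rewrite -(ltr_pM2r D0) normE => l2; nra.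
Qed.

End Packing.

(** * Signal strength and reception *)

Section Physics.
Variables (R : realType) (alpha beta eps P noise : R).
Hypotheses (alpha_gt2 : 2 < alpha) (noise_gt0 : 0 < noise) (beta_ge1 : 1 <= beta).
Hypotheses (eps_bounds : 0 < eps < 1) (P_gt0 : 0 < P).
Variables (n : nat) (pos : 'I_n -> R * R).
Hypothesis pos_inj : injective pos.

Notation dst u v := (dist (pos u) (pos v)).
Notation rc := (receives alpha beta eps P noise pos).
Notation adjG := (adj alpha beta eps P noise pos).

Lemma dist_sym (x y : R * R) : dist x y = dist y x.
Proof. by rewrite /dist -(sqrrN (x.1 - _)) opprB -(sqrrN (x.2 - _)) opprB. Qed.

Lemma dist_gt0 u v : u != v -> 0 < dst u v.
Proof.
move=> neq; rewrite /dist sqrtr_gt0 lt_neqAle addr_ge0 ?sqr_ge0// andbT eq_sym.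
apply: contra neq; rewrite paddr_eq0 ?sqr_ge0// !sqrf_eq0 !subr_eq0 => /andP[].
by move=> /eqP e1 /eqP e2; apply/eqP/pos_inj; apply: injective_projections.
Qed.

Lemma adjG_sym : symmetric adjG.
Proof. by move=> u v; rewrite /adj eq_sym dist_sym. Qed.

Let alpha_gt0 : 0 < alpha. Proof. by apply: lt_trans alpha_gt2. Qed.

Let beta_gt0 : 0 < beta. Proof. exact: lt_le_trans beta_ge1. Qed.

(** At distance [sinr_range] the signal is exactly [beta * noise], and neighbours are within the
    shorter [comm_range]. *)
Lemma adj_signal v u : adjG v u -> beta * noise <= signal alpha P pos v u.
Proof.
rewrite /adj => /andP[neq].
have d0 := dist_gt0 neq; rewrite /comm_range /sinr_range /signal powRN.
set X := P / (noise * beta) => le_d.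
have X0 : 0 < X by rewrite divr_gt0// mulr_gt0.
have le_d' : dst v u <= X `^ alpha^-1.
  apply: le_trans le_d _; rewrite ler_piMl ?powR_ge0//.
  by case/andP: eps_bounds => /ltW e0 _; rewrite gerBl.
have : dst v u `^ alpha <= X.
  have -> : X = (X `^ alpha^-1) `^ alpha.
    by rewrite -powRrM mulVf ?gt_eqF// powRr1// ltW.
  by apply: ge0_ler_powR => //; rewrite ?nnegrE ?powR_ge0 ?ltW.
rewrite /X ler_pdivlMr ?mulr_gt0// => le_P.
by rewrite ler_pdivlMr ?powR_gt0// mulrC (mulrC beta).
Qed.

Lemma signal_lt v w u : v != u -> w != u ->
  signal alpha P pos w u < signal alpha P pos v u -> dst v u < dst w u.
Proof.
move=> vu wu; rewrite /signal ltr_pM2l// !powRN ltf_pV2 ?posrE ?powR_gt0 ?dist_gt0//.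
rewrite !ltNge; apply: contra => le_d.
by apply: ge0_ler_powR => //; rewrite ?nnegrE ?ltW ?dist_gt0.
Qed.

Lemma signal_gt0 w u : w != u -> 0 < signal alpha P pos w u.
Proof. by move=> wu; rewrite mulr_gt0 ?powR_gt0 ?dist_gt0. Qed.

Lemma receives_sole v u : rc [set v] v u = adjG v u.
Proof.
rewrite /receives /adj !inE eqxx /= eq_sym; case: eqVneq => //= vu.
case le_d : (_ <= comm_range _ _ _ _ _); rewrite ?andbF// andbT.
have -> : [set v] :\ v = finset.set0 by apply/setP=> w; rewrite !inE andNb.
rewrite big_set0 addr0 ler_pdivlMr//.
by apply: adj_signal; rewrite /adj vu.
Qed.

(** The interference includes the signal of [w], so [beta >= 1] and positive noise make the signal
    of [v] strictly stronger; signals decrease with distance. *)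
Lemma receives_nearer T v u w : rc T v u -> w \in T -> w != v -> dst v u < dst w u.
Proof.
case/and4P=> vT uT + _ wT wv.
have neq_u z : z \in T -> z != u by move=> zT; apply: contraNneq uT => <-.
rewrite (big_setD1 w) ?inE ?wv//=; set S := \sum_(_ in _) _ => le_b.
have S0 : 0 <= S.
  by apply: sumr_ge0 => z; rewrite !inE => /and3P[_ _ /neq_u zu]; exact/ltW/signal_gt0.
have w0 := signal_gt0 (neq_u _ wT).
apply: signal_lt; rewrite ?neq_u//.
have den : signal alpha P pos w u < noise + (signal alpha P pos w u + S).
  by rewrite addrCA ltrDl ltr_wpDr.
have den0 := lt_trans w0 den.
move: le_b; rewrite ler_pdivlMr// => le_b; apply: lt_le_trans le_b.
by apply: lt_le_trans den _; rewrite ler_peMl// ltW.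
Qed.

Lemma nearer_card_le7 v (F : {set 'I_n}) :
  {in F &, forall u w, u != w -> dst v u < dst w u} -> (#|F| <= 7)%N.
Proof.
move=> sep; apply: (@kissing7 R _ (fun u => (pos u).1 - (pos v).1)
  (fun u => (pos u).2 - (pos v).2)) => u w uF wF neq.
(* With [v] as origin, [sep] for the pair [w], [u] squares to the inequality that [kissing7] asks
   for [u], [w]; hence the swap. *)
rewrite eq_sym in neq; have := sep w u wF uF neq; rewrite /= /dist ltr_sqrt; last first.
  by have := dist_gt0 neq; rewrite dist_sym /dist sqrtr_gt0.
nra.
Qed.

End Physics.

(** * The algorithm *)

(** Two leading bits give the kind of packet. Every packet carries the rumor, so that being awake
    means being informed. *)
Definition encode pk : option msg :=
  match pk with
  | Silence => None
  | Call x => Some (true, [:: false, false & x])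
  | Beep => Some (true, [:: false; true])
  | Reply x => Some (true, [:: true, false & x])
  | Token x => Some (true, [:: true, true & x])
  end.

Definition decode (o : option msg) :=
  match o with
  | Some (_, false :: false :: x) => Call x
  | Some (_, false :: true :: _) => Beep
  | Some (_, true :: false :: x) => Reply x
  | Some (_, true :: true :: x) => Token x
  | _ => Silence
  end.

Lemma encodeK : cancel encode decode.
Proof. by case. Qed.

Lemma encode_rumor pk m : encode pk = Some m -> m.1.
Proof. by case: pk => //= [x||x|x] [<-]. Qed.

(** The state is arbitrary because the message bound must hold for arbitrary histories; [take L] is
    what limits tokens. *)
Lemma size_encode L k x m : encode (emit L k x) = Some m -> (size m.2 <= L.+2)%N.
Proof.
have code_le : (size (code L k) <= L)%N by rewrite size_code.
case: x => //= [j p|j p hd]; first by case: sends => // -[<-] /=.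
case: ifP => _; first by case=> <-.
case: ifP => _; first by case=> <-.
case: ifP => _ // [<-] /=; by rewrite size_take_min !ltnS geq_minl.
Qed.

Definition width N := (trunc_log 2 N).+1.

Definition run L nm (is_src : bool) (h : seq (option msg)) :=
  foldl (fun x o => next L nm x (decode o))
    (if is_src then Hold 0 [::] None else Idle) h.

(** For [N < 2] the bound on control bits is a multiple of [ln N = 0], so the algorithm stays
    silent. *)
Definition wireless_dfs : algorithm := Algorithm (fun _ _ => 0%N)
  (fun nm N _ is_src _ h =>
     if (N < 2)%N then None
     else encode (emit (width N) nm (run (width N) nm is_src h))).

(** * The SINR execution simulates the abstract protocol *)

Section Simulation.
Variables (R : realType) (alpha beta eps P noise : R) (n : nat).
Variables (pos : 'I_n -> R * R) (name : 'I_n -> nat) (N Delta : nat).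
Variables (source : 'I_n) (tape : 'I_n -> seq bool).
Hypothesis N_ge2 : (2 <= N)%N.

Notation cfg := (config_at alpha beta eps P noise pos wireless_dfs name N Delta
  source tape).
Notation recv := (received alpha beta eps P noise pos wireless_dfs name N Delta
  source tape).
Notation act := (action wireless_dfs name N Delta source tape).
Notation L := (width N).

Definition sinr_rx (T : {set 'I_n}) u :=
  [pick v | receives alpha beta eps P noise pos T v u].

Notation global t := (iter t (gstep sinr_rx name L) (start source)).

Definition local (c : config n) v :=
  if c v is Some h then run L (name v) (v == source) h else Idle.

Lemma actionE c v : (forall h, c v = Some h -> knows_rumor source v h) ->
  act c v = encode (emit L (name v) (local c v)).
Proof.
rewrite /action /local; case: (c v) => [h|//] /(_ h erefl) kn.
rewrite /= ltnNge N_ge2 /=; case e: encode => [[b x]|//] /=.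
by rewrite kn andbT.
Qed.

Lemma cfgS t : cfg t.+1 = step alpha beta eps P noise pos wireless_dfs name N Delta
  source tape (cfg t).
Proof. by []. Qed.

Lemma awake_mono t t' v : (t <= t')%N -> cfg t v -> cfg t' v.
Proof.
move=> /subnK <-; elim: (_ - _)%N => // k IH /IH.
by rewrite addSn cfgS /step; case: (cfg _ v).
Qed.

Lemma awake_source t : cfg t source.
Proof.
by apply: (awake_mono (leq0n t)); rewrite /config_at /= /init_config eqxx.
Qed.

(** Both claims go through one induction: knowledge of the rumor keeps sent packets unaltered, and
    packets carrying the rumor inform whoever they wake. Sleeping nodes count as [Idle], and a node
    woken by anything but a call stays [Idle]. *)
Lemma simulation t : (forall v, local (cfg t) v = global t v) /\
  forall v h, cfg t v = Some h -> knows_rumor source v h.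
Proof.
elim: t => [|t [IH kn]].
  split=> [v|v h]; rewrite /config_at /= /local /init_config /start.
    by case: eqVneq.
  by case: eqVneq => // -> [<-]; rewrite /knows_rumor eqxx.
have actE v : act (cfg t) v = encode (on_air name L (global t) v).
  by rewrite actionE ?IH//; exact: kn.
have recvE u : recv (cfg t) u = encode (hear sinr_rx name L (global t) u).
  rewrite /received /hear /sinr_rx.
  have -> : transmitters wireless_dfs name N Delta source tape (cfg t) =
      air name L (global t).
    by apply/setP=> v; rewrite !inE actE; case: on_air.
  by case: pickP => [v _|//]; rewrite actE.
split=> [v|v h].
  rewrite iterS /gstep -IH /local cfgS /step recvE.
  case e: (cfg t v) => [h|]; first by rewrite /run foldl_rcons encodeK.
  have /negbTE vs : v != source.
    by apply/eqP => vs; rewrite vs in e; have := awake_source t; rewrite e.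
  by case: hear => //= [x||x|x]; rewrite vs.
rewrite cfgS /step recvE; case e: (cfg t v) => [h'|].
  move=> [<-]; have := kn _ _ e; rewrite /knows_rumor has_rcons.
  by case/orP=> ->; rewrite ?orbT.
case e': encode => [m|//] [<-]; rewrite /knows_rumor /= (encode_rumor e').
by rewrite orbT.
Qed.

Lemma active_broadcast_done t t' : (t <= t')%N ->
  (forall v, active (global t v)) ->
  broadcast_done alpha beta eps P noise pos wireless_dfs name N Delta source tape t'.
Proof.
move=> le_t allact; apply/forallP => v; rewrite /informed_at.
have [loc _] := simulation t; have [_ kn] := simulation t'.
have : cfg t' v.
  apply: awake_mono le_t _.
  by have := allact v; rewrite -loc /local; case: (cfg t v).
by case e: (cfg t' v) => [h|//] _; exact: kn e.
Qed.

End Simulation.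

Section Broadcast.
Variables (R : realType) (alpha beta eps P noise : R).
Hypotheses (alpha_gt2 : 2 < alpha) (noise_gt0 : 0 < noise) (beta_ge1 : 1 <= beta).
Hypotheses (eps_bounds : 0 < eps < 1) (P_gt0 : 0 < P).
Variables (n : nat) (pos : 'I_n -> R * R) (name : 'I_n -> nat) (N Delta : nat).
Variables (source : 'I_n) (tape : 'I_n -> seq bool).
Hypotheses (pos_inj : injective pos) (name_inj : injective name).
Hypothesis name_le : forall v, (1 <= name v <= N)%N.
Hypothesis connected : graph_connected alpha beta eps P noise pos.

Notation done := (broadcast_done alpha beta eps P noise pos wireless_dfs name N
  Delta source tape).

Lemma wireless_dfs_time t : (2 <= N)%N -> (16 * n * width N ^ 2 <= t)%N -> done t.
Proof.
move=> N2 le_t.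
have name_lt v : (name v < 2 ^ width N)%N.
  case/andP: (name_le v) => _ /leq_ltn_trans -> //.
  exact: trunc_log_ltn.
have [|T u v|v F|t' le_t' allact] := @all_active _ (adj alpha beta eps P noise pos)
  (sinr_rx alpha beta eps P noise pos)
  (fun u v w => dist (pos v) (pos u) < dist (pos w) (pos u)) name (width N)
  isT name_lt name_inj (adjG_sym _ _ _ _ _ _) _ _ _ source (connected source).
- move=> v u; rewrite /sinr_rx; case: pickP => [w rw|none].
    have wv : w = v by case/and4P: rw => /set1P.
    by move: rw; rewrite wv receives_sole// => ->.
  by have := none v; rewrite receives_sole// => ->.
- rewrite /sinr_rx; case: pickP => // w rw [<-].
  case/and4P: (rw) => wT uT _ le_d; split=> //.
    by rewrite /adj le_d andbT; apply: contraNneq uT => <-.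
  by move=> z; exact: (receives_nearer alpha_gt2 noise_gt0 beta_ge1 P_gt0 pos_inj rw).
- exact: nearer_card_le7.
apply: active_broadcast_done allact => //; apply: leq_trans le_t.
(* With [L = width N >= 1], [2 * L + 4 * L ^ 2 + 2 <= 8 * L ^ 2]; times [2 * n] sessions this gives
   the factor 16. *)
apply: leq_trans le_t' _; rewrite card_ord -mul2n.
have : (1 <= width N)%N by [].
nia.
Qed.

End Broadcast.

Lemma success_prob_eq1 (R : realType) (alpha beta eps P noise : R) (n : nat)
  (pos : 'I_n -> R * R) (A : algorithm) (name : 'I_n -> nat) (N : nat)
  (source : 'I_n) (t : nat) :
  (forall Delta tape, broadcast_done alpha beta eps P noise pos A name N Delta
     source tape t) ->
  success_prob alpha beta eps P noise pos A name N source t = 1.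
Proof.
move=> bd; rewrite /success_prob; set S := [set tp | _].
have -> : S = [set: _] by apply/setP=> tp; rewrite !inE bd.
by rewrite cardsT divff// pnatr_eq0 card_ffun card_tuple card_bool -lt0n
  !expn_gt0.
Qed.

(** The factor 2 absorbs the [.+1] of [width], using [ln 2 <= ln N]. *)
Lemma width_le_ln (R : realType) N : (2 <= N)%N ->
  (width N)%:R <= 2 / ln 2 * ln (N%:R : R).
Proof.
move=> N2; have ln2_gt0 : 0 < ln (2 : R) by rewrite ln_gt0 ?ltr1n.
have : (trunc_log 2 N)%:R * ln 2 <= ln (N%:R : R).
  rewrite mulr_natl -lnXn ?ltr0n// ler_ln ?posrE ?exprn_gt0 ?ltr0n ?(ltnW N2)//.
  by rewrite -natrX ler_nat trunc_logP// ltnW.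
have : ln 2 <= ln (N%:R : R) by rewrite ler_ln ?posrE ?ltr0n ?(ltnW N2)// ler_nat.
rewrite mulrAC ler_pdivlMr// /width -addn1 natrD mulrDl mul1r; lra.
Qed.

Theorem theorem1 (R : realType) (alpha beta eps P noise : R) :
  2 < alpha -> 0 < noise -> 1 <= beta -> 0 < eps < 1 -> 0 < P ->
  forall d : nat, (1 <= d)%N ->
  exists (A : algorithm) (C : R),
    0 < C /\
    (forall N Delta : nat, (alg_bits A N Delta)%:R <= C * ln (N%:R : R) ^+ 3) /\
    (forall (nm N Delta : nat) (is_src : bool) (tp : seq bool)
            (h : seq (option msg)) (m : msg),
        alg_act A nm N Delta is_src tp h = Some m ->
        (size m.2)%:R <= C * ln (N%:R : R)) /\
    (forall (n N : nat) (pos : 'I_n -> R * R) (name : 'I_n -> nat) (source : 'I_n),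
        injective pos -> injective name ->
        (forall v, 1 <= name v <= N)%N ->
        graph_connected alpha beta eps P noise pos ->
        forall t : nat, C * n%:R * ln (N%:R : R) ^+ 2 <= t%:R ->
        1 - (n%:R ^- d) <= success_prob alpha beta eps P noise pos A name N source t).
Proof.
move=> alpha_gt2 noise_gt0 beta_ge1 eps_bounds P_gt0 d _.
have ln2_gt0 : 0 < ln (2 : R) by rewrite ln_gt0 ?ltr1n.
pose K : R := 2 / ln 2; have K_gt0 : 0 < K by rewrite divr_gt0.
have ln_ge0 N : 0 <= ln (N%:R : R).
  by case: N => [|N]; [rewrite ln0|rewrite ln_ge0// ler1n].
(* [3 * K] pays for messages, since [width N + 2 <= 3 * width N], and [16 * K ^+ 2] for the
   [16 * n * width N ^ 2] rounds. *)
exists wireless_dfs, (3 * K + 16 * K ^+ 2); split; first by nra.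
split=> [N Delta|]; first by rewrite mulr_ge0 ?exprn_ge0//; nra.
split=> [nm N Delta is_src tp h m|n N pos name source pos_inj name_inj name_le conn t le_t].
  rewrite /=; case: ltnP => // N2 /size_encode szm.
  have := width_le_ln R N2; rewrite -/K => leW.
  have : (size m.2)%:R <= (width N)%:R + 2 :> R by rewrite -natrD ler_nat addn2.
  have : 1 <= (width N)%:R :> R by rewrite ler1n.
  have := ln_ge0 N; nra.
rewrite success_prob_eq1; first by rewrite gerBl invr_ge0 exprn_ge0.
move=> Delta tape; have [N2|N_lt2] := leqP 2 N.
  apply: wireless_dfs_time => //.
  rewrite -(ler_nat R); apply: le_trans le_t.
  have := width_le_ln R N2; rewrite -/K => leW.
  have leW2 : (width N)%:R ^+ 2 <= K ^+ 2 * ln (N%:R : R) ^+ 2.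
    have KlnN : 0 <= K * ln (N%:R : R) by rewrite mulr_ge0 ?(ltW K_gt0).
    by rewrite -exprMn; apply: lerXn2r; rewrite ?nnegrE.
  rewrite natrM natrX natrM; have n0 : 0 <= n%:R :> R by [].
  have ln2N : 0 <= ln (N%:R : R) ^+ 2 by rewrite sqr_ge0.
  apply: (@le_trans _ _ (16 * n%:R * (K ^+ 2 * ln (N%:R : R) ^+ 2))).
    by rewrite ler_wpM2l// mulr_ge0.
  rewrite mulrA ler_wpM2r// mulrAC ler_wpM2r//; lra.
(* For [N < 2] all names equal 1, so the source is the only node and is informed from the start. *)
have name1 v : name v = 1%N.
  by case/andP: (name_le v) => n1 n2; apply/eqP; rewrite eqn_leq n1 andbT (leq_trans n2).
apply/forallP => v; have -> : v = source by apply: name_inj; rewrite !name1.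
rewrite /informed_at; have := awake_source alpha beta eps P noise pos name N
  Delta source tape t.
by case: config_at => // h _; rewrite /knows_rumor eqxx.
Qed.
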